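(* Let $f$ be a real continuous function defined on an interval $\mathcal{E}\subset\mathbb{R}$, and assume that $f$ is the primitive of a function that is operator monotone on the interior of $\mathcal{E}$. Then, for every $m\ge 1$ and every $m\times m$ hermitian matrix $A$ with spectrum in $\mathcal{E}$, the function $2^{[m]}\to\mathbb{R}$, $I\mapsto \operatorname{tr} f(A[I])$, is supermodular; that is, for all $I,J\subset[m]$, $$\operatorname{tr} f(A[I])+\operatorname{tr} f(A[J])\le \operatorname{tr} f(A[I\cup J])+\operatorname{tr} f(A[I\cap J]).$$
   Context: $[m]=\{1,\dots,m\}$ and $2^{[m]}$ is the set of all its subsets. For $I\subset[m]$, $A[I]$ is the principal submatrix of $A$ obtained by deleting the rows and columns with index in $[m]\setminus I$. By convention $\operatorname{tr} f(A[\emptyset]):=0$ for every function $f$. For a hermitian matrix $A=U\operatorname{diag}(\lambda_1,\dots,\lambda_m)U^*$ with $U$ unitary, $f(A)=U\operatorname{diag}(f(\lambda_1),\dots,f(\lambda_m))U^*$, so $\operatorname{tr} f(A)=\sum_i f(\lambda_i)$. A real function $g$ is operator monotone on an interval if for all $n\ge1$ and all $n\times n$ complex hermitian matrices $A,B$ with spectrum in that interval, $A\preceq B$ implies $g(A)\preceq g(B)$, where $A\preceq B$ means that $B-A$ is nonnegative definite (positive semidefinite). *)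

(* Defs.v *)
From HB Require Import structures.
From mathcomp Require Import all_boot all_order all_algebra.
From mathcomp Require Import complex.
From mathcomp Require Import all_classical all_reals all_analysis.

Set Implicit Arguments.
Unset Strict Implicit.
Unset Printing Implicit Defensive.

Import Order.TTheory GRing.Theory Num.Theory.
Import numFieldNormedType.Exports.

Local Open Scope classical_set_scope.
Local Open Scope ring_scope.
Local Open Scope sesquilinear_scope.
Local Open Scope complex_scope.

Section MatrixFunctions.
Variable R : realType.

(* [spectralmx A] is unitary and, for hermitian [A],
   [A = (spectralmx A)^t* *m diag_mx (spectral_diag A) *m spectralmx A] with
   [spectral_diag A] real; the value does not depend on the diagonalization
   ([mxfunE]). *)
Definition mxfun (f : R -> R) n (A : 'M[R[i]]_n) : 'M[R[i]]_n :=
  (spectralmx A)^t*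
    *m diag_mx (map_mx (fun z => (f (complex.Re z))%:C) (spectral_diag A))
    *m spectralmx A.

(* The trace of [mxfun f A] is real ([tr_mxfun]), so taking its real part only
   changes its type. *)
Definition trfun (f : R -> R) n (A : 'M[R[i]]_n) : R :=
  complex.Re (\tr (mxfun f A)).

Definition spectrum_in (S : set R) n (A : 'M[R[i]]_n) : Prop :=
  forall z : R[i], eigenvalue A z -> exists2 x : R, S x & z = x%:C.

(* In [R[i]], [0 <= z] means that [z] is real and nonnegative. *)
Definition psdmx n (A : 'M[R[i]]_n) : Prop :=
  A \is hermsymmx /\ forall v : 'cV[R[i]]_n, 0 <= (v^t* *m A *m v) 0 0.

Definition loewner_le n (A B : 'M[R[i]]_n) : Prop := psdmx (B - A).

Definition operator_monotone (S : set R) (g : R -> R) : Prop :=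
  forall n (A B : 'M[R[i]]_n), (1 <= n)%N ->
    A \is hermsymmx -> B \is hermsymmx ->
    spectrum_in S A -> spectrum_in S B ->
    loewner_le A B -> loewner_le (mxfun g A) (mxfun g B).

Definition primitive_on (S : set R) (f g : R -> R) : Prop :=
  forall x, S x -> is_derive x 1 f (g x).

(* [enum_val] lists the elements of [I] in increasing order. *)
Definition principal_submx m (I : {set 'I_m}) (A : 'M[R[i]]_m) :
  'M[R[i]]_#|I| := mxsub enum_val enum_val A.

Definition supermodular m (F : {set 'I_m} -> R) : Prop :=
  forall I J : {set 'I_m},
    F I + F J <= F (I :|: J)%SET + F (I :&: J)%SET.

Lemma mxfunE (f : R -> R) n (A U : 'M[R[i]]_n) (d : 'rV[R]_n) :
  U \is unitarymx -> A = U *m diag_mx (map_mx (real_complex R) d) *m U^t* ->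
  mxfun f A = U *m diag_mx (map_mx (fun x => (f x)%:C) d) *m U^t*.
Proof.
move=> Uu AE.
have Anormal : A \is normalmx.
  apply/orthomx_spectral_subproof.
  exists (U^t*, map_mx (real_complex R) d) => /=; first by rewrite trmxC_unitary.
  by rewrite invmx_unitary ?trmxC_unitary// trmxCK.
have /orthomx_spectralP := Anormal.
have Pu := spectral_unitarymx A.
rewrite invmx_unitary// /mxfun.
move: (spectralmx A) (spectral_diag A) Pu => P s Pu As.
have PPt : P *m P^t* = 1%:M by apply/unitarymxP.
have PtP : P^t* *m P = 1%:M by exact: mulmx1C.
have UUt : U *m U^t* = 1%:M by apply/unitarymxP.
have UtU : U^t* *m U = 1%:M by exact: mulmx1C.
have comm : diag_mx s *m (P *m U)
          = (P *m U) *m diag_mx (map_mx (real_complex R) d).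
  have : P *m A *m U = P *m A *m U by [].
  rewrite {1}As {1}AE => h.
  rewrite !mulmxA PPt mul1mx -!mulmxA UtU mulmx1 !mulmxA in h.
  by rewrite mulmxA.
set D := diag_mx (map_mx _ s); set D' := diag_mx (map_mx _ d).
have {}comm : D *m (P *m U) = (P *m U) *m D'.
  apply/matrixP => i j; move/matrixP: comm => /(_ i j).
  rewrite !mul_diag_mx !mul_mx_diag !mxE.
  have [->|nz] := eqVneq (\sum_k P i k * U k j) 0; first by rewrite !mulr0 !mul0r.
  by move=> h; rewrite [RHS]mulrC (mulIf nz (etrans h (mulrC _ _))).
have -> : U *m D' *m U^t* = P^t* *m (P *m U *m D') *m U^t*.
  by rewrite !mulmxA PtP mul1mx.
by rewrite -comm -!mulmxA UUt mulmx1.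
Qed.

Lemma tr_mxfun (f : R -> R) n (A : 'M[R[i]]_n) :
  \tr (mxfun f A) = (\sum_i f (complex.Re (spectral_diag A 0 i)))%:C.
Proof.
rewrite /mxfun mxtrace_mulC mulmxA.
have /unitarymxP -> := spectral_unitarymx A.
rewrite mul1mx mxtrace_diag rmorph_sum.
by apply: eq_bigr => i _; rewrite mxE.
Qed.

Lemma trfunE (f : R -> R) n (A : 'M[R[i]]_n) :
  trfun f A = \sum_i f (complex.Re (spectral_diag A 0 i)).
Proof. by rewrite /trfun tr_mxfun. Qed.

Lemma trfun_set0 (f : R -> R) m (A : 'M[R[i]]_m) :
  trfun f (principal_submx finset.set0 A) = 0.
Proof.
by rewrite trfunE big1// => i; exfalso; case: i => i; rewrite cards0.
Qed.

End MatrixFunctions.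

(* Main.v *)
Require Import Defs.
From mathcomp Require Import all_boot all_order all_algebra.
From mathcomp Require Import complex.
From mathcomp Require Import all_classical all_reals all_analysis.
From mathcomp Require Import ring lra.

Set Implicit Arguments.
Unset Strict Implicit.
Unset Printing Implicit Defensive.

Import Order.TTheory GRing.Theory Num.Theory.
Import numFieldNormedType.Exports.

Local Open Scope classical_set_scope.
Local Open Scope ring_scope.
Local Open Scope sesquilinear_scope.
Local Open Scope complex_scope.

(** The defect of supermodularity of I |-> tr f(A[I]) is a second difference of tr f
    in two positive semidefinite directions. Such a second difference is
    nonnegative because the derivative of tr f at X in the direction W is
    tr (g(X) W), with g = f' operator monotone.

    Passing to Gram matrices makes the directions appear. Suppose first that the
    spectrum of A lies in the interior S of the interval, and let c be the
    largest eigenvalue of A. Then c - A = Y^* Y for a square matrix Y, and A[I] =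
    c - Y_I^* Y_I where Y_I keeps the columns of Y with index in I. Since
    Y_I^* Y_I and Y_I Y_I^* have the same nonzero eigenvalues, tr f(A[I]) equals
    tr f(c - Y_I Y_I^* ) up to a multiple of f(c) that is affine in the
    cardinality of I, hence irrelevant for supermodularity
    ([trfun_principal_submx]). But Y_I Y_I^* is the sum over I of the rank one
    matrices y_i y_i^*, so it is additive in I. With
    M = c - Y_(I u J) Y_(I u J)^* and the positive semidefinite increments V, W
    carried by I \ J and J \ I, the four matrices attached to I u J, J, I and
    I n J are M, M + V, M + W and M + V + W. All of them lie between the
    smallest eigenvalue of A and c, so their spectra remain in S.

    What is left is
      tr f(M + V) + tr f(M + W) <= tr f(M) + tr f(M + V + W)
    ([trfun_increasing_differences]). Along T(s) = M + s W, Klein's inequality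
    tr f(Y) - tr f(X) >= tr (g(X) (Y - X)) ([trfun_tangent]) replaces every use of
    a derivative, and g(T(s) + V) >= g(T(s)) compares the two increments.
    Summing over a subdivision of [0, 1] into N steps, the errors telescope to
    1/N times a difference of the two end values of tr (g(T(s)) W)
    ([le_of_increment_ge]).

    When A has eigenvalues at an end of the interval, A is replaced by
    (1 - t) A + t e with e an interior point, and t tends to 0. If the interior
    is empty, all the eigenvalues are equal and the function is modular. *)

(** * Hermitian and positive semidefinite matrices *)

Section Hermitian.
Variable R : realType.
Implicit Types (n m : nat).
Local Notation C := R[i].
Local Notation cdiag d := (diag_mx (map_mx (real_complex R) d)).
Local Notation Re := (@complex.Re R).

Lemma hermsymmxP n (A : 'M[C]_n) : (A \is hermsymmx) <-> A^t* = A.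
Proof.
split=> [/is_hermitianmxP|h]; first by rewrite expr0 scale1r => <-.
by apply/is_hermitianmxP; rewrite expr0 scale1r h.
Qed.

Lemma trmxC_mul m n p (A : 'M[C]_(m, n)) (B : 'M[C]_(n, p)) :
  (A *m B)^t* = B^t* *m A^t*.
Proof. by rewrite trmx_mul map_mxM. Qed.

Lemma trmxCD m n (A B : 'M[C]_(m, n)) : (A + B)^t* = A^t* + B^t*.
Proof. by rewrite linearD map_mxD. Qed.

Lemma trmxCB m n (A B : 'M[C]_(m, n)) : (A - B)^t* = A^t* - B^t*.
Proof. by rewrite linearB map_mxB. Qed.

Lemma col_mulmx m n p (A : 'M[C]_(m, n)) (B : 'M[C]_(n, p)) j :
  col j (A *m B) = A *m col j B.
Proof. by rewrite !colE mulmxA. Qed.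

Lemma conjC_real (x : R) : (x%:C)^*%R = x%:C.
Proof. exact: conjc_real. Qed.

Lemma trmxC_cdiag n (d : 'rV[R]_n) : (cdiag d)^t* = cdiag d.
Proof.
rewrite tr_diag_mx map_diag_mx -map_mx_comp; congr diag_mx.
by apply/matrixP => i j; rewrite !mxE /= conjC_real.
Qed.

Lemma trmxC_scalar n (x : R) : (x%:C%:M : 'M[C]_n)^t* = x%:C%:M.
Proof. by rewrite tr_scalar_mx map_scalar_mx /= conjC_real. Qed.

Lemma hermsymmxD n (A B : 'M[C]_n) :
  A \is hermsymmx -> B \is hermsymmx -> A + B \is hermsymmx.
Proof.
by move=> /hermsymmxP hA /hermsymmxP hB; apply/hermsymmxP; rewrite trmxCD hA hB.
Qed.

Lemma hermsymmxB n (A B : 'M[C]_n) :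
  A \is hermsymmx -> B \is hermsymmx -> A - B \is hermsymmx.
Proof.
by move=> /hermsymmxP hA /hermsymmxP hB; apply/hermsymmxP; rewrite trmxCB hA hB.
Qed.

Lemma hermsymmx_scalar n (x : R) : (x%:C%:M : 'M[C]_n) \is hermsymmx.
Proof. by apply/hermsymmxP; exact: trmxC_scalar. Qed.

Lemma hermsymmx_congr m n (X : 'M[C]_(m, n)) (d : 'rV[R]_n) :
  X *m cdiag d *m X^t* \is hermsymmx.
Proof.
by apply/hermsymmxP; rewrite !trmxC_mul trmxCK trmxC_cdiag mulmxA.
Qed.

Lemma unitarymx1 n : (1%:M : 'M[C]_n) \is unitarymx.
Proof. by apply/unitarymxP; rewrite trmx1 map_mx1 mulmx1. Qed.

Lemma unitarymxKl n (U : 'M[C]_n) : U \is unitarymx -> U *m U^t* = 1%:M.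
Proof. by move/unitarymxP. Qed.

Lemma unitarymxKr n (U : 'M[C]_n) : U \is unitarymx -> U^t* *m U = 1%:M.
Proof. by move=> /unitarymxP h; exact: mulmx1C. Qed.

Lemma hermsymmx_spectral n (A : 'M[C]_n) : A \is hermsymmx ->
  exists U (d : 'rV[R]_n), U \is unitarymx /\ A = U *m cdiag d *m U^t*.
Proof.
move=> hA; have Pu := spectral_unitarymx A.
have /orthomx_spectralP := hermitian_normalmx hA.
have /mxOverP dR := hermitian_spectral_diag_real hA.
rewrite invmx_unitary// => AE.
exists ((spectralmx A)^t*), (map_mx Re (spectral_diag A)).
have dE : spectral_diag A = map_mx (real_complex R) (map_mx Re (spectral_diag A)).
  by apply/matrixP => i j; rewrite !mxE RRe_real.
rewrite trmxC_unitary trmxCK -dE; split; [exact: Pu | exact: AE].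
Qed.

Lemma trfun_diag (f : R -> R) n (A U : 'M[C]_n) (d : 'rV[R]_n) :
  U \is unitarymx -> A = U *m cdiag d *m U^t* ->
  trfun f A = \sum_i f (d 0 i).
Proof.
move=> Uu AE; rewrite /trfun (mxfunE f Uu AE) mxtrace_mulC mulmxA.
rewrite unitarymxKr// mul1mx mxtrace_diag.
under eq_bigr do rewrite mxE.
by rewrite -rmorph_sum.
Qed.

Lemma spectrum_in_diag (S : set R) n (U : 'M[C]_n) (d : 'rV[R]_n) :
  U \is unitarymx ->
  spectrum_in S (U *m cdiag d *m U^t*) <-> forall i, S (d 0 i).
Proof.
move=> Uu; split=> [h i|h z /eigenvalueP[v vE v0]].
  have /h[x Sx /complexI -> //] : eigenvalue (U *m cdiag d *m U^t*) (d 0 i)%:C.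
  apply/eigenvalueP; exists (row i (U^t*)).
    rewrite !mulmxA -row_mul unitarymxKr// row1 -rowE row_diag_mx mxE.
    by rewrite -scalemxAl -rowE.
  apply/eqP => /(congr1 (mulmx^~ U)).
  rewrite -row_mul unitarymxKr// mul0mx => /rowP /(_ i).
  by rewrite !mxE eqxx => /eqP; rewrite oner_eq0.
have w0 : v *m U != 0.
  apply: contraNneq v0 => e.
  by rewrite -(mulmx1 v) -(unitarymxKl Uu) mulmxA e mul0mx.
have [i wi] : exists i, (v *m U) 0 i != 0.
  apply/existsP; apply: contraNT w0 => /existsPn h0; apply/eqP/rowP => i.
  by rewrite [RHS]mxE; apply/eqP; rewrite -[_ == _]negbK h0.
exists (d 0 i) => //.
(* w = v U is a nonzero row with w D = z w, so z is the entry of D at an index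
   where w does not vanish. *)
have : v *m U *m cdiag d = z *: (v *m U).
  have := congr1 (mulmx^~ U) vE.
  by rewrite /= -scalemxAl !mulmxA -(mulmxA _ (U^t*)) unitarymxKr// mulmx1.
move=> /rowP /(_ i); rewrite mul_mx_diag !mxE => e.
by move: wi; rewrite mxE => wi; apply/(mulIf wi); rewrite -e mulrC.
Qed.

Lemma psdmx_congr m n (X : 'M[C]_(m, n)) (d : 'rV[R]_n) :
  (forall i, 0 <= d 0 i) -> psdmx (X *m cdiag d *m X^t*).
Proof.
move=> d0; split=> [|v]; first exact: hermsymmx_congr.
rewrite !mulmxA -(mulmxA _ (X^t*)).
have -> : v^t* *m X = (X^t* *m v)^t* by rewrite trmxC_mul trmxCK.
set w := X^t* *m v.
rewrite mul_mx_diag mxE sumr_ge0// => i _.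
rewrite !mxE mulrAC mulr_ge0 ?ler0c// mulrC; exact: mul_conjC_ge0.
Qed.

Lemma psdmx_diag n (U : 'M[C]_n) (d : 'rV[R]_n) : U \is unitarymx ->
  psdmx (U *m cdiag d *m U^t*) <-> forall i, 0 <= d 0 i.
Proof.
move=> Uu; split=> [[_ h] i|]; last exact: psdmx_congr.
have := h (col i U).
rewrite !mulmxA -(mulmxA _ (U^t*)).
have -> : (col i U)^t* *m U = (delta_mx 0 i : 'rV_n).
  rewrite tr_col map_row -row_mul.
  by rewrite (unitarymxKr Uu) row1.
have -> : U^t* *m col i U = (delta_mx i 0 : 'cV_n).
  by rewrite -col_mulmx unitarymxKr// col1.
by rewrite -rowE row_diag_mx -scalemxAl mul_delta_mx !mxE !eqxx mulr1 ler0c.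
Qed.

Lemma psdmxD n (A B : 'M[C]_n) : psdmx A -> psdmx B -> psdmx (A + B).
Proof.
move=> [hA pA] [hB pB]; split=> [|v]; first exact: hermsymmxD.
by rewrite mulmxDr mulmxDl mxE addr_ge0.
Qed.

Lemma psdmxZ n (A : 'M[C]_n) (x : R) : 0 <= x -> psdmx A -> psdmx (x%:C *: A).
Proof.
move=> x0 [hA pA]; split=> [|v]; last first.
  by rewrite -scalemxAr -scalemxAl mxE mulr_ge0// ler0c.
apply/hermsymmxP; rewrite linearZ /= map_mxZ /= conjC_real.
by congr (_ *: _); apply/hermsymmxP.
Qed.

(** With B = U D U^*, the trace of A B is the sum of the eigenvalues of B weighted
    by the values of the quadratic form of A on the columns of U. *)
Lemma psdmx_tr_mul n (A B : 'M[C]_n) :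
  psdmx A -> psdmx B -> 0 <= Re (\tr (A *m B)).
Proof.
move=> [_ pA] pB; have [U [d [Uu BE]]] := hermsymmx_spectral pB.1.
have d0 : forall i, 0 <= d 0 i by apply/(psdmx_diag d Uu); rewrite -BE.
have : 0 <= \tr (A *m B).
  have -> : \tr (A *m B) = \tr (U^t* *m A *m U *m cdiag d).
    by rewrite BE !mulmxA mxtrace_mulC !mulmxA.
  rewrite mul_mx_diag sumr_ge0// => i _; rewrite mxE [map_mx _ _ _ _]mxE.
  rewrite mulr_ge0 ?ler0c//.
  have -> : (U^t* *m A *m U) i i = ((col i U)^t* *m A *m col i U) 0 0.
    rewrite tr_col map_row -!row_mul -col_mulmx !mxE.
    by apply: eq_bigr => k _; rewrite !mxE.
  exact: pA.
by rewrite lecE => /andP[].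
Qed.

Lemma scalar_unitary_diag n (U : 'M[C]_n) (x : R) : U \is unitarymx ->
  x%:C%:M = U *m cdiag (const_mx x) *m U^t*.
Proof.
move=> Uu; rewrite map_const_mx diag_const_mx -scalemx1 -scalemxAr.
by rewrite mulmx1 -scalemxAl unitarymxKl// scalemx1.
Qed.

Lemma unitary_diagB n (U : 'M[C]_n) (d e : 'rV[R]_n) :
  U *m cdiag d *m U^t* - U *m cdiag e *m U^t* = U *m cdiag (d - e) *m U^t*.
Proof. by rewrite map_mxB linearB mulmxBr mulmxBl. Qed.

Lemma psdmx_diag_ge n (U : 'M[C]_n) (d : 'rV[R]_n) (a : R) : U \is unitarymx ->
  psdmx (U *m cdiag d *m U^t* - a%:C%:M) <-> forall i, a <= d 0 i.
Proof.
move=> Uu; rewrite (scalar_unitary_diag a Uu) unitary_diagB psdmx_diag//.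
by split=> h i; have := h i; rewrite !mxE subr_ge0.
Qed.

Lemma psdmx_diag_le n (U : 'M[C]_n) (d : 'rV[R]_n) (c : R) : U \is unitarymx ->
  psdmx (c%:C%:M - U *m cdiag d *m U^t*) <-> forall i, d 0 i <= c.
Proof.
move=> Uu; rewrite (scalar_unitary_diag c Uu) unitary_diagB psdmx_diag//.
by split=> h i; have := h i; rewrite !mxE subr_ge0.
Qed.

End Hermitian.

(** * Traces of matrix functions under positive semidefinite increments *)

Section Trace.
Variable R : realType.
Implicit Types (n m : nat) (S : set R) (f g : R -> R).
Local Notation C := R[i].
Local Notation cdiag d := (diag_mx (map_mx (real_complex R) d)).
Local Notation Re := (@complex.Re R).

Lemma mxtrace_mul_conj (F : comNzRingType) n (U U' W W' D E : 'M[F]_n) :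
  \tr (U *m D *m U' *m (W *m E *m W')) = \tr (D *m (U' *m W *m E *m (W' *m U))).
Proof. by rewrite -!(mulmxA U) mxtrace_mulC !mulmxA. Qed.

(** Klein's inequality. With X = U x U^* and Y = W y W^*, the squared moduli p i j
    of the entries of the unitary matrix Q = U^* W have row and column sums 1, and
    every term of the inequality is a p-weighted sum of the scalar tangent
    inequalities between x i and y j. *)
Lemma trfun_tangent S f g n (X Y : 'M[C]_n) :
  (forall x y, S x -> S y -> f x + g x * (y - x) <= f y) ->
  X \is hermsymmx -> Y \is hermsymmx -> spectrum_in S X -> spectrum_in S Y ->
  trfun f X + Re (\tr (mxfun g X *m (Y - X))) <= trfun f Y.
Proof.
move=> tangent /hermsymmx_spectral[U [x [Uu XE]]] /hermsymmx_spectral[W [y [Wu YE]]].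
move=> SX SY.
have Sx : forall i, S (x 0 i) by apply/(spectrum_in_diag S x Uu); rewrite -XE.
have Sy : forall j, S (y 0 j) by apply/(spectrum_in_diag S y Wu); rewrite -YE.
rewrite (trfun_diag f Uu XE) (trfun_diag f Wu YE).
pose gx := map_mx g x.
have gxE : map_mx (fun z => (g z)%:C) x = map_mx (real_complex R) gx.
  by apply/matrixP => i j; rewrite !mxE.
have gXE := mxfunE g Uu XE; rewrite gxE in gXE.
pose Q := U^t* *m W.
have Qu : Q \is unitarymx by rewrite mul_unitarymx ?trmxC_unitary.
pose p i j : R := Re (Q i j * (Q i j)^*%R).
have pE i j : (p i j)%:C = Q i j * (Q i j)^*%R.
  by rewrite /p RRe_real// ger0_real// mul_conjC_ge0.
have p0 i j : 0 <= p i j.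
  by rewrite -(@ler0c R) pE mul_conjC_ge0.
have pr i : \sum_j p i j = 1.
  apply: (@complexI R); rewrite rmorph_sum rmorph1.
  have /matrixP/(_ i i) := unitarymxKl Qu; rewrite !mxE eqxx /= => h; apply: etrans h.
  by apply: eq_bigr => j _; rewrite pE !mxE.
have pc j : \sum_i p i j = 1.
  apply: (@complexI R); rewrite rmorph_sum rmorph1.
  have /matrixP/(_ j j) := unitarymxKr Qu; rewrite !mxE eqxx /= => h; apply: etrans h.
  by apply: eq_bigr => i _; rewrite pE !mxE mulrC.
have trXY : \tr (mxfun g X *m Y) = (\sum_i \sum_j p i j * (g (x 0 i) * y 0 j))%:C.
  have QtE : Q^t* = W^t* *m U by rewrite trmxC_mul trmxCK.
  rewrite gXE YE mxtrace_mul_conj -QtE -/Q.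
  rewrite mul_diag_mx mul_mx_diag rmorph_sum /=.
  apply: eq_bigr => i _; rewrite !mxE mulr_sumr rmorph_sum /=.
  by apply: eq_bigr => j _; rewrite !rmorphM /= pE !mxE; ring.
have trXX : \tr (mxfun g X *m X) = (\sum_i g (x 0 i) * x 0 i)%:C.
  have -> : \tr (mxfun g X *m X) =
      \tr (U *m cdiag gx *m U^t* *m (U *m cdiag x *m U^t*)) by rewrite gXE -XE.
  rewrite mxtrace_mul_conj.
  rewrite (unitarymxKr Uu).
  rewrite mul1mx mulmx1.
  rewrite mul_diag_mx rmorph_sum /=.
  by apply: eq_bigr => i _; rewrite !mxE eqxx mulr1n rmorphM.
rewrite mulmxBr linearB /= trXY trXX -rmorphB /=.
have -> : \sum_j f (y 0 j) = \sum_i \sum_j p i j * f (y 0 j).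
  rewrite exchange_big /=; apply: eq_bigr => j _.
  by rewrite -mulr_suml pc mul1r.
rewrite -sumrB -big_split /=; apply: ler_sum => i _.
rewrite -[f (x 0 i)]mul1r -[g (x 0 i) * x 0 i]mul1r -(pr i) !mulr_suml.
rewrite -sumrB -big_split /=; apply: ler_sum => j _.
rewrite -mulrBr -mulrDr; apply: ler_wpM2l => //.
by rewrite -mulrBr tangent.
Qed.

Lemma mxfun_scalar g n (x : R) :
  mxfun g (x%:C%:M : 'M[C]_n) = (g x)%:C%:M.
Proof.
have U1 := unitarymx1 R n.
rewrite (mxfunE g U1 (scalar_unitary_diag x U1)) (scalar_unitary_diag (g x) U1).
by congr (_ *m diag_mx _ *m _); apply/matrixP => i j; rewrite !mxE.
Qed.

Lemma spectrum_in_scalar S n (x : R) : S x -> spectrum_in S (x%:C%:M : 'M[C]_n).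
Proof.
have U1 := unitarymx1 R n.
by move=> Sx; rewrite (scalar_unitary_diag x U1) spectrum_in_diag// => i; rewrite mxE.
Qed.

Lemma loewner_le_scalar n (x y : R) : (0 < n)%N ->
  loewner_le (x%:C%:M : 'M[C]_n) y%:C%:M <-> x <= y.
Proof.
case: n => // n _.
have U1 := unitarymx1 R n.+1.
rewrite /loewner_le (scalar_unitary_diag y U1) psdmx_diag_ge//.
by split=> [/(_ ord0)|xy i]; rewrite mxE.
Qed.

(** Operator monotonicity for matrices of size 1. *)
Lemma operator_monotone_nondecreasing S g x y : operator_monotone S g ->
  S x -> S y -> x <= y -> g x <= g y.
Proof.
move=> gm Sx Sy xy; have := gm 1%N x%:C%:M y%:C%:M isT.
rewrite !mxfun_scalar !loewner_le_scalar//.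
by apply=> //; [exact: hermsymmx_scalar | exact: hermsymmx_scalar
               | exact: spectrum_in_scalar | exact: spectrum_in_scalar].
Qed.

Lemma primitive_tangent S f g x y : is_interval S ->
  {in S &, {homo g : x y / x <= y}} -> primitive_on S f g ->
  S x -> S y -> f x + g x * (y - x) <= f y.
Proof.
move=> iS gm fg Sx Sy; have [xy|yx|->] := ltgtP x y; last by rewrite subrr mulr0 addr0.
- have dv z : z \in `]x, y[%R -> is_derive z 1 f (g z).
    rewrite in_itv /= => /andP[/ltW xz /ltW zy].
    by apply: fg; apply: (iS x y) => //; rewrite xz.
  have ct : {within `[x, y], continuous f}.
    apply: derivable_within_continuous => z; rewrite in_itv /= => xzy.
    by have [] := fg z (iS x y Sx Sy z xzy).
  have [z] := MVT xy dv ct; rewrite in_itv /= => /andP[xz zy] fxy.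
  rewrite -lerBrDl fxy ler_wpM2r ?subr_ge0 ?(ltW xy)// gm ?inE ?ltW//.
  by apply: (iS x y) => //; rewrite !ltW.
- have dv z : z \in `]y, x[%R -> is_derive z 1 f (g z).
    rewrite in_itv /= => /andP[/ltW yz /ltW zx].
    by apply: fg; apply: (iS y x) => //; rewrite yz.
  have ct : {within `[y, x], continuous f}.
    apply: derivable_within_continuous => z; rewrite in_itv /= => xzy.
    by have [] := fg z (iS y x Sy Sx z xzy).
  have [z] := MVT yx dv ct; rewrite in_itv /= => /andP[yz zx] fxy.
  have -> : f y = f x - g z * (x - y) by rewrite -fxy; ring.
  rewrite lerD2l -mulrN opprB ler_wnM2r ?subr_le0 ?(ltW yx)// gm ?inE ?ltW//.
  by apply: (iS y x) => //; rewrite !ltW.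
Qed.

(** The defect of monotonicity of psi on a step is bounded by the step times the
    increment of u. Over N equal steps these defects telescope to
    (u 0 - u 1) / N, which is arbitrarily small. *)
Lemma le_of_increment_ge (psi u : R -> R) :
  (forall s t : R, 0 <= s -> s <= t -> t <= 1 ->
    (t - s) * (u s - u t) <= psi t - psi s) ->
  psi 0 <= psi 1.
Proof.
move=> h; rewrite leNgt; apply/negP => lt10.
have e0 : 0 < psi 0 - psi 1 by rewrite subr_gt0.
pose N := Num.bound `|(u 1 - u 0) / (psi 0 - psi 1)|.
have hN : u 1 - u 0 < N.+1%:R * (psi 0 - psi 1).
  rewrite -ltr_pdivrMr//; apply: le_lt_trans (ler_norm _) _.
  apply: lt_trans (archi_boundP (normr_ge0 _)) _.
  by rewrite ltr_nat ltnS /N.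
have N0 : 0 < N.+1%:R :> R by rewrite ltr0n.
have step j : (j <= N.+1)%N ->
    N.+1%:R^-1 * (u 0 - u (j%:R / N.+1%:R)) <= psi (j%:R / N.+1%:R) - psi 0.
  elim: j => [|j IH] jN; first by rewrite mul0r !subrr mulr0.
  have := IH (ltnW jN); have := h (j%:R / N.+1%:R) (j.+1%:R / N.+1%:R).
  rewrite -mulrBl -natrB// subSnn mul1r => /(_ _ _ _)/wrap[].
  - by rewrite divr_ge0.
  - by rewrite ler_pM2r ?invr_gt0// ler_nat.
  - by rewrite ler_pdivrMr// mul1r ler_nat.
  move=> h1 h2; have -> : psi (j.+1%:R / N.+1%:R) - psi 0 =
    psi (j%:R / N.+1%:R) - psi 0 + (psi (j.+1%:R / N.+1%:R) - psi (j%:R / N.+1%:R)).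
    by rewrite [RHS]addrC addrA subrK.
  by apply: le_trans (lerD h2 h1); rewrite -mulrDr addrA subrK.
have := step N.+1 (leqnn _); rewrite divff ?gt_eqF// ler_pdivrMl//.
by move=> h1; lra.
Qed.

(** Membership of a spectrum in an interval, through two Loewner bounds, which
    unlike spectra are stable under addition of positive semidefinite matrices. *)
Lemma psdmx_between n (T : 'M[C]_n) S a c : is_interval S -> S a -> S c ->
  psdmx (T - a%:C%:M) -> psdmx (c%:C%:M - T) ->
  T \is hermsymmx /\ spectrum_in S T.
Proof.
move=> iS Sa Sc Ta Tc.
have hT : T \is hermsymmx.
  by rewrite -[T](subrK a%:C%:M) hermsymmxD ?hermsymmx_scalar//; case: Ta.
split=> //; have [U [d [Uu TE]]] := hermsymmx_spectral hT.
move: Ta Tc; rewrite TE psdmx_diag_ge// psdmx_diag_le// => ad dc.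
by rewrite spectrum_in_diag// => i; apply: (iS a c) => //; rewrite ad dc.
Qed.

Lemma secant_combine (s t us ut w fs ft fsV ftV : R) :
  ft + (s - t) * ut <= fs -> fsV + (t - s) * w <= ftV ->
  (t - s) * us <= (t - s) * w ->
  (t - s) * (us - ut) <= ftV - ft - (fsV - fs).
Proof. by nra. Qed.

Lemma sub_add_split (Z : zmodType) (c x v w w' : Z) :
  c - (x + w' + v) = c - (x + v + w) + (w - w').
Proof. by rewrite !opprD !addrA subrK addrAC. Qed.

(** Along T s = M + s W, Klein's inequality bounds the increment of tr f(T + V) from
    below by a value of g at the start of the step, and that of tr f(T) from above
    by a value of g at its end. Operator monotonicity removes V from the first
    value; both are then values of u s = tr (g(T s) W), and [le_of_increment_ge]
    applies. *)
Lemma trfun_increasing_differences S f g n (M V W : 'M[C]_n) a c : (0 < n)%N ->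
  is_interval S -> operator_monotone S g -> primitive_on S f g ->
  S a -> S c -> psdmx V -> psdmx W ->
  psdmx (M - a%:C%:M) -> psdmx (c%:C%:M - (M + V + W)) ->
  trfun f (M + V) + trfun f (M + W) <= trfun f M + trfun f (M + V + W).
Proof.
move=> n0 iS gm fg Sa Sc pV pW Ma Mc.
have tangent x y : S x -> S y -> f x + g x * (y - x) <= f y.
  apply: primitive_tangent => // x' y' /set_mem Sx /set_mem Sy.
  exact: operator_monotone_nondecreasing gm Sx Sy.
pose T s := M + s%:C *: W.
have spTV s : 0 <= s -> s <= 1 ->
    T s + V \is hermsymmx /\ spectrum_in S (T s + V).
  move=> s0 s1; apply: (psdmx_between iS Sa Sc).
    have -> : T s + V - a%:C%:M = M - a%:C%:M + s%:C *: W + V.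
      by rewrite (addrAC (T s)) (addrAC M).
    exact: (psdmxD (psdmxD Ma (psdmxZ s0 pW)) pV).
  rewrite (sub_add_split _ M V W (s%:C *: W)) -[X in X - _ *: W]scale1r -scalerBl.
  rewrite -(rmorphB (real_complex R) 1).
  have s1' : 0 <= 1 - s by rewrite subr_ge0.
  exact: (psdmxD Mc (psdmxZ s1' pW)).
have spT s : 0 <= s -> s <= 1 -> T s \is hermsymmx /\ spectrum_in S (T s).
  move=> s0 s1; apply: (psdmx_between iS Sa Sc).
    rewrite (addrAC M); exact: (psdmxD Ma (psdmxZ s0 pW)).
  have -> : c%:C%:M - T s = c%:C%:M - (M + V + W) + (1 - s)%:C *: W + V.
    rewrite (rmorphB (real_complex R) 1) scalerBl scale1r -sub_add_split.
    by rewrite (opprD (T s)) addrA subrK.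
  have s1' : 0 <= 1 - s by rewrite subr_ge0.
  exact: (psdmxD (psdmxD Mc (psdmxZ s1' pW)) pV).
pose u s := Re (\tr (mxfun g (T s) *m W)).
have TB s t : T t - T s = (t - s)%:C *: W.
  by rewrite /T opprD addrACA subrr add0r rmorphB scalerBl.
have ReZ (G : 'M[C]_n) (x : R) : Re (\tr (G *m (x%:C *: W))) = x * Re (\tr (G *m W)).
  by rewrite -scalemxAr linearZ /=; case: (\tr _) => p q /=; rewrite mul0r subr0.
pose psi s := trfun f (T s + V) - trfun f (T s).
have : psi 0 <= psi 1.
  apply: (le_of_increment_ge (psi := psi) (u := u)) => s t s0 st t1.
  have [t0 s1] : 0 <= t /\ s <= 1 by split;
    [exact: le_trans s0 st | exact: le_trans st t1].
  have [hs Ss] := spT _ s0 s1; have [ht St] := spT _ t0 t1.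
  have [hsV SsV] := spTV _ s0 s1; have [htV StV] := spTV _ t0 t1.
  have := trfun_tangent tangent ht hs St Ss; rewrite TB ReZ -/(u t) => k1.
  have := trfun_tangent tangent hsV htV SsV StV.
  have -> : T t + V - (T s + V) = T t - T s.
    by rewrite (opprD (T s)) addrACA subrr addr0.
  rewrite TB ReZ => k2.
  have le_g : loewner_le (mxfun g (T s)) (mxfun g (T s + V)).
    apply: gm n0 hs hsV Ss SsV _.
    by rewrite /loewner_le (addrC (T s)) addrK; exact: pV.
  have : u s <= Re (\tr (mxfun g (T s + V) *m W)).
    have := psdmx_tr_mul le_g pW; rewrite mulmxBl linearB /= raddfB.
    by rewrite subr_ge0.
  have ts0 : 0 <= t - s by rewrite subr_ge0.
  move=> /(ler_wpM2l ts0) k3.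
  exact: secant_combine k1 k2 k3.
rewrite /psi /T scale0r scale1r addr0 (addrAC M V W).
by rewrite lerBlDr [leRHS]addrAC lerBrDr [leRHS]addrC.
Qed.

End Trace.

(** * Principal submatrices and Gram matrices *)

(** Sylvester's identity. Let B be the block matrix with rows (y, X) and (Y, 1). A
    column operation gives det B = det (y - X Y), a row operation gives
    y ^ k * det B = y ^ m * det (y - Y X). *)
Lemma det_scalar_sub_mulmxC (F : comNzRingType) m k
    (X : 'M[F]_(m, k)) (Y : 'M[F]_(k, m)) (y : F) :
  y ^+ k * \det (y%:M - X *m Y) = y ^+ m * \det (y%:M - Y *m X).
Proof.
pose B := block_mx y%:M X Y 1%:M.
have detB : \det B = \det (y%:M - X *m Y).
  have : \det (B *m block_mx 1%:M 0 (- Y) 1%:M) = \det B.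
    by rewrite det_mulmx det_lblock !det1 !mulr1.
  rewrite mulmx_block !mulmx1 !mulmx0 !mulmxN mul1mx subrr !add0r det_ublock det1.
  by rewrite mulr1.
have : \det (block_mx 1%:M 0 (- Y) y%:M *m B) = y ^+ m * \det (y%:M - Y *m X).
  rewrite mulmx_block !mul1mx !mul0mx !mulNmx !addr0 mulmx1 mul_mx_scalar mul_scalar_mx.
  by rewrite addNr det_ublock det_scalar [_ + y%:M]addrC.
by rewrite det_mulmx det_lblock det1 mul1r det_scalar detB.
Qed.

Lemma char_poly_scalar_sub_mulmxC (F : comNzRingType) m k
    (X : 'M[F]_(m, k)) (Y : 'M[F]_(k, m)) (c : F) :
  char_poly (c%:M - X *m Y) * ('X - c%:P) ^+ k =
  char_poly (c%:M - Y *m X) * ('X - c%:P) ^+ m.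
Proof.
have E p q (P : 'M[F]_(p, q)) (Q : 'M[F]_(q, p)) :
    char_poly (c%:M - P *m Q) =
    \det (('X - c%:P)%:M - map_mx polyC (- P) *m map_mx polyC Q).
  rewrite /char_poly /char_poly_mx; congr (\det _).
  rewrite map_mxB map_scalar_mx -map_mxM mulNmx map_mxN opprK opprB raddfB /=.
  by rewrite addrA addrAC.
rewrite E mulrC det_scalar_sub_mulmxC mulrC; congr (_ * _).
by rewrite E map_mxN mulmxN map_mxN mulNmx.
Qed.

Lemma char_poly_mulmxC (F : idomainType) n (X Y : 'M[F]_n) :
  char_poly (X *m Y) = char_poly (Y *m X).
Proof.
have /mulIf : ('X - (0 : F)%:P) ^+ n != 0 by rewrite expf_neq0// polyXsubC_eq0.
apply; have := char_poly_scalar_sub_mulmxC (- X) Y 0.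
by rewrite mulNmx mulmxN !raddf0 !add0r !opprK.
Qed.

Lemma subrDK (Z : zmodType) (c x y : Z) : c - (x + y) + y = c - x.
Proof. by rewrite opprD addrA subrK. Qed.

Section Reduction.
Variable R : realType.
Implicit Types (n m : nat) (S : set R) (f g : R -> R).
Local Notation C := R[i].
Local Notation cdiag d := (diag_mx (map_mx (real_complex R) d)).
Local Notation Re := (@complex.Re R).

Lemma char_poly_unitary_diag n (U : 'M[C]_n) (d : 'rV[R]_n) : U \is unitarymx ->
  char_poly (U *m cdiag d *m U^t*) =
  \prod_(z <- [seq (d 0 i)%:C | i <- enum 'I_n]) ('X - z%:P).
Proof.
move=> Uu; rewrite char_poly_mulmxC mulmxA (unitarymxKr Uu) mul1mx.
rewrite char_poly_trig ?diag_mx_is_trig// big_map -big_enum /=.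
by apply: eq_bigr => i _; rewrite !mxE eqxx mulr1n.
Qed.

(** The trace of f(A) depends only on the roots of the characteristic polynomial,
    counted with multiplicity; the powers of 'X - c account for matrices of
    different sizes that differ by copies of the eigenvalue c. *)
Lemma trfun_char_poly f n n' (A : 'M[C]_n) (B : 'M[C]_n') (c : R) p q :
  A \is hermsymmx -> B \is hermsymmx ->
  char_poly A * ('X - c%:C%:P) ^+ p = char_poly B * ('X - c%:C%:P) ^+ q ->
  trfun f A + f c *+ p = trfun f B + f c *+ q.
Proof.
move=> /hermsymmx_spectral[U [x [Uu AE]]] /hermsymmx_spectral[W [y [Wu BE]]].
rewrite (trfun_diag f Uu AE) (trfun_diag f Wu BE) AE BE !char_poly_unitary_diag//.
have E k : ('X - c%:C%:P) ^+ k = \prod_(z <- nseq k c%:C) ('X - z%:P).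
  by rewrite big_nseq -Monoid.iteropE.
rewrite !E -!big_cat => /prod_XsubC_eq.
have mapE k (z : 'rV[R]_k) l : [seq (z 0 i)%:C | i <- enum 'I_k] ++ nseq l c%:C =
    map (real_complex R) ([seq z 0 i | i <- enum 'I_k] ++ nseq l c).
  by rewrite map_cat map_nseq -(map_comp (real_complex R)).
rewrite !mapE => /(perm_map_inj (@complexI R)) eq_spec.
have : \sum_(z <- [seq x 0 i | i <- enum 'I_n] ++ nseq p c) f z =
    \sum_(z <- [seq y 0 i | i <- enum 'I_n'] ++ nseq q c) f z.
  exact: perm_big.
by rewrite !big_cat 2!big_map !big_nseq -!Monoid.iteropE !big_enum.
Qed.

Lemma principal_submx_scalar_sub_gram m k (I : {set 'I_m}) (c : C) (Y : 'M[C]_(k, m)) :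
  principal_submx I (c%:M - Y^t* *m Y) =
  c%:M - (colsub (@enum_val _ (mem I)) Y)^t* *m colsub enum_val Y.
Proof.
apply/matrixP => i j; rewrite !mxE (inj_eq enum_val_inj).
by congr (_ - _); apply: eq_bigr => l _; rewrite !mxE.
Qed.

(** Selecting columns through a diagonal matrix makes their Gram matrix
    Y *m diag (indicator_row I) *m Y^* linear in the row, so that set operations
    on I become entrywise identities. *)
Definition indicator_row m (I : {set 'I_m}) : 'rV[R]_m := \row_i (i \in I)%:R.

Lemma colsub_gram m k (I : {set 'I_m}) (Y : 'M[C]_(k, m)) :
  (colsub (@enum_val _ (mem I)) Y) *m (colsub enum_val Y)^t* =
  Y *m cdiag (indicator_row I) *m Y^t*.
Proof.
apply/matrixP => a b; rewrite mul_mx_diag !mxE.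
rewrite [RHS](eq_bigr (fun i => if i \in I then Y a i * (Y b i)^*%R else 0));
  last first.
  by move=> i _; rewrite !mxE; case: (i \in I); rewrite ?mulr1 ?mulr0 ?mul0r.
rewrite -big_mkcond /= [RHS]big_enum_val /=.
by apply: eq_bigr => i _; rewrite !mxE.
Qed.

(** Replacing the #|I| x #|I| Gram matrix of the selected columns by the k x k one
    changes the trace by k - #|I| copies of f c, a modular function of I. *)
Lemma trfun_principal_submx f m k (I : {set 'I_m}) (c : R) (Y : 'M[C]_(k, m)) :
  trfun f (principal_submx I (c%:C%:M - Y^t* *m Y)) + f c *+ k =
  trfun f (c%:C%:M - Y *m cdiag (indicator_row I) *m Y^t*) + f c *+ #|I|.
Proof.
rewrite principal_submx_scalar_sub_gram -colsub_gram.
apply: trfun_char_poly; last exact: char_poly_scalar_sub_mulmxC.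
  apply: hermsymmxB; first exact: hermsymmx_scalar.
  by apply/hermsymmxP; rewrite trmxC_mul trmxCK.
apply: hermsymmxB; first exact: hermsymmx_scalar.
by apply/hermsymmxP; rewrite trmxC_mul trmxCK.
Qed.

Lemma le_add_modular (p q u v p' q' u' v' k : R) : p' + q' = u' + v' ->
  p + q <= u + v -> (p + p' - k) + (q + q' - k) <= (u + u' - k) + (v + v' - k).
Proof. by move=> ? ?; lra. Qed.

Lemma row_extrema m (d : 'rV[R]_m) : (0 < m)%N ->
  exists i j, forall k, d 0 i <= d 0 k <= d 0 j.
Proof.
case: m d => // m d _.
have [i _ hi] := @Order.TotalTheory.arg_minP _ _ _ ord0 xpredT (fun i => d 0 i) isT.
have [j _ hj] := @Order.TotalTheory.arg_maxP _ _ _ ord0 xpredT (fun i => d 0 i) isT.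
by exists i, j => k; apply/andP; split; [exact: hi | exact: hj].
Qed.

(** The matrices attached to I :|: J, J, I and I :&: J are M, M + V, M + W and
    M + V + W, where V and W collect the columns of Y in I :\: J and J :\: I. *)
Lemma supermodular_trfun_principal_submx S f g m (A : 'M[C]_m) : (0 < m)%N ->
  is_interval S -> operator_monotone S g -> primitive_on S f g ->
  A \is hermsymmx -> spectrum_in S A ->
  supermodular (fun I : {set 'I_m} => trfun f (principal_submx I A)).
Proof.
move=> m0 iS gm fg /hermsymmx_spectral[U [d [Uu AE]]] SA.
have Sd : forall i, S (d 0 i) by apply/(spectrum_in_diag S d Uu); rewrite -AE.
have [i0 [i1 dle]] := row_extrema d m0.
pose a := d 0 i0; pose c := d 0 i1.
have [Sa Sc] : S a /\ S c by split; exact: Sd.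
have ad i : a <= d 0 i by case/andP: (dle i).
have dc i : d 0 i <= c by case/andP: (dle i).
(* Y Y^* = c - diag d, so that c - Y Y^* >= a, the bound that keeps M inside S. *)
pose r : 'rV[R]_m := \row_i Num.sqrt (c - d 0 i).
pose Y := cdiag r *m U^t*.
have rr : cdiag r *m cdiag r = cdiag (const_mx c - d).
  rewrite mulmx_diag; congr diag_mx; apply/matrixP => i j.
  by rewrite !mxE -rmorphM -expr2 sqr_sqrtr ?subr_ge0 ?ord1.
have YtE : Y^t* = U *m cdiag r by rewrite trmxC_mul trmxCK trmxC_cdiag.
have AY : A = c%:C%:M - Y^t* *m Y.
  rewrite YtE /Y mulmxA -(mulmxA U) rr -unitary_diagB -(scalar_unitary_diag c Uu).
  by rewrite opprB addrC subrK.
have dE : cdiag d = c%:C%:M - Y *m Y^t*.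
  have -> : Y *m Y^t* = cdiag (const_mx c - d).
    by rewrite YtE /Y mulmxA -(mulmxA _ (U^t*)) (unitarymxKr Uu) mulmx1.
  by rewrite map_mxB map_const_mx raddfB /= diag_const_mx opprB addrC subrK.
pose G (p : 'rV[R]_m) := Y *m cdiag p *m Y^t*.
have GD p q : G (p + q) = G p + G q.
  by rewrite /G map_mxD raddfD mulmxDr mulmxDl.
have GB p q : c%:C%:M - G p + G q = c%:C%:M - G (p - q).
  have -> : G p = G (p - q) + G q by rewrite -GD subrK.
  exact: subrDK.
move=> I J.
pose u K := trfun f (c%:C%:M - G (indicator_row K)).
suff : u I + u J <= u (I :|: J)%SET + u (I :&: J)%SET.
  have E K : trfun f (principal_submx K A) = u K + f c *+ #|K| - f c *+ m.
    by rewrite /u AY -trfun_principal_submx addrK.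
  have cIJ : f c *+ #|I| + f c *+ #|J| =
      f c *+ #|(I :|: J)%SET| + f c *+ #|(I :&: J)%SET|.
    by rewrite -!mulrnDr cardsUI.
  by rewrite !E; apply: le_add_modular.
pose M := c%:C%:M - G (indicator_row (I :|: J)%SET).
have EV : M + G (indicator_row (I :\: J)%SET) = c%:C%:M - G (indicator_row J).
  rewrite GB; congr (_ - G _); apply/rowP => i; rewrite !mxE !inE.
  by case: (i \in I); case: (i \in J); rewrite /= ?subrr ?subr0.
have EW : M + G (indicator_row (J :\: I)%SET) = c%:C%:M - G (indicator_row I).
  rewrite GB; congr (_ - G _); apply/rowP => i; rewrite !mxE !inE.
  by case: (i \in I); case: (i \in J); rewrite /= ?subrr ?subr0.
have EVW : M + G (indicator_row (I :\: J)%SET) + G (indicator_row (J :\: I)%SET) =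
    c%:C%:M - G (indicator_row (I :&: J)%SET).
  rewrite EV GB; congr (_ - G _); apply/rowP => i; rewrite !mxE !inE.
  by case: (i \in I); case: (i \in J); rewrite /= ?subrr ?subr0.
have G0 (K : {set 'I_m}) : psdmx (G (indicator_row K)).
  by apply: psdmx_congr => i; rewrite mxE ler0n.
have GT : G (indicator_row [set: 'I_m]%SET) = Y *m Y^t*.
  have rowT : map_mx (real_complex R) (indicator_row [set: 'I_m]%SET) = const_mx 1.
    by apply/matrixP => i j; rewrite !mxE inE.
  by rewrite /G rowT diag_const_mx mulmx1.
have ME : M = cdiag d + G (indicator_row (~: (I :|: J))%SET).
  rewrite dE -GT GB /M; congr (_ - G _); apply/rowP => i; rewrite !mxE !inE.
  by case: (i \in I); case: (i \in J); rewrite /= ?subrr ?subr0.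
have Ma : psdmx (M - a%:C%:M).
  rewrite ME (addrAC (cdiag d)).
  apply: psdmxD; last exact: G0.
  have /(_ a)[_] := psdmx_diag_ge d _ (unitarymx1 R m).
  by rewrite mul1mx trmx1 map_mx1 mulmx1; apply.
have Mc : psdmx (c%:C%:M -
    (M + G (indicator_row (I :\: J)%SET) + G (indicator_row (J :\: I)%SET))).
  rewrite EVW opprB addrC subrK; exact: G0.
have uI : u I = trfun f (M + G (indicator_row (J :\: I)%SET)) by rewrite EW.
have uJ : u J = trfun f (M + G (indicator_row (I :\: J)%SET)) by rewrite EV.
have uIJ : u (I :&: J)%SET =
    trfun f (M + G (indicator_row (I :\: J)%SET) + G (indicator_row (J :\: I)%SET)).
  by rewrite EVW.
rewrite uI uJ uIJ [leLHS]addrC.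
exact: (trfun_increasing_differences m0 iS gm fg Sa Sc (G0 _) (G0 _) Ma Mc).
Qed.

End Reduction.

(** * Approximation from the interior of the interval *)

Section Boundary.
Variable R : realType.
Implicit Types (n m : nat) (S : set R) (f g : R -> R).
Local Notation C := R[i].
Local Notation cdiag d := (diag_mx (map_mx (real_complex R) d)).

(** A point z near y = (1 - t) x + t e is (1 - t) x + t z' with
    z' = e + (z - y) / t. This z' is near e, hence in S, and z lies between x
    and z'. *)
Lemma interior_convex S x e t : is_interval S -> S x -> (interior S) e ->
  0 < t -> t <= 1 -> (interior S) ((1 - t) * x + t * e).
Proof.
move=> iS Sx /nbhs_ballP[r /= r0 er] t0 t1.
apply/nbhs_ballP; exists (t * r) => /=; first exact: mulr_gt0.
move=> z /=; rewrite /ball /= => zr.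
pose z' := e + (z - ((1 - t) * x + t * e)) / t.
have Sz' : S z'.
  apply: er; rewrite /ball /= /z' opprD addNKr normrN normrM normfV (gtr0_norm t0).
  by rewrite ltr_pdivrMr// distrC (mulrC r).
have zE : z = (1 - t) * x + t * z'.
  by rewrite /z' mulrDr mulrCA divff ?gt_eqF//; ring.
have [xz'|/ltW z'x] := leP x z'.
- apply: (iS x z') => //; apply/andP; split; rewrite zE; nra.
- apply: (iS z' x) => //; apply/andP; split; rewrite zE; nra.
Qed.

Lemma is_interval_interior S : is_interval S -> is_interval (interior S).
Proof.
move=> iS x y Sx Sy z /andP[]; rewrite le_eqVlt => /predU1P[<-//|xz] zy.
have xy : 0 < y - x by rewrite subr_gt0 (lt_le_trans xz).
have -> : z = (1 - (z - x) / (y - x)) * x + (z - x) / (y - x) * y.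
  by field; rewrite gt_eqF.
apply: interior_convex => //; first exact: interior_subset Sx.
  by rewrite divr_gt0// subr_gt0.
by rewrite ler_pdivrMr// mul1r lerD2r.
Qed.

Lemma is_interval_interior0 S x y : is_interval S -> ~ (interior S !=set0) ->
  S x -> S y -> x = y.
Proof.
move=> iS; wlog xy : x y / x <= y.
  move=> h Si Sx Sy; have [xy|/ltW yx] := leP x y; first exact: h.
  by rewrite (h _ _ yx).
move=> Si Sx Sy; apply/eqP/negPn/negP => nxy; apply: Si.
have {nxy}xy : x < y by rewrite lt_neqAle nxy.
exists ((x + y) / 2).
have : nbhs ((x + y) / 2) `]x, y[%classic.
  have mid : (x + y) / 2 \in `]x, y[ by rewrite in_itv /= !midf_lt.
  exact: near_in_itvoo mid.
apply: filterS => z /=; rewrite in_itv /= => /andP[xz zy].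
by apply: (iS x y) => //; rewrite !ltW.
Qed.

Lemma principal_submx_diag m (I : {set 'I_m}) (U : 'M[C]_m) (d : 'rV[R]_m) :
  principal_submx I (U *m cdiag d *m U^t*) =
  rowsub enum_val U *m cdiag d *m (rowsub enum_val U)^t*.
Proof.
apply/matrixP => i j; rewrite !mul_mx_diag !mxE.
by apply: eq_bigr => k _; rewrite !mxE.
Qed.

Lemma principal_submxB m (I : {set 'I_m}) (A B : 'M[C]_m) :
  principal_submx I (A - B) = principal_submx I A - principal_submx I B.
Proof. by apply/matrixP => i j; rewrite !mxE. Qed.

Lemma principal_submx_scalar m (I : {set 'I_m}) (z : C) :
  principal_submx I z%:M = z%:M.
Proof. by apply/matrixP => i j; rewrite !mxE (inj_eq enum_val_inj). Qed.

Lemma psdmx_principal_submx m (I : {set 'I_m}) (A : 'M[C]_m) :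
  psdmx A -> psdmx (principal_submx I A).
Proof.
move=> pA; have [U [d [Uu AE]]] := hermsymmx_spectral pA.1.
have d0 : forall i, 0 <= d 0 i by apply/(psdmx_diag d Uu); rewrite -AE.
by rewrite AE principal_submx_diag; exact: psdmx_congr.
Qed.

(** Cauchy interlacing, in the weak form that principal submatrices inherit the
    Loewner bounds of A by its extreme eigenvalues. *)
Lemma spectrum_in_principal_submx S m (I : {set 'I_m}) (A : 'M[C]_m) :
  (0 < m)%N -> is_interval S -> A \is hermsymmx -> spectrum_in S A ->
  principal_submx I A \is hermsymmx /\ spectrum_in S (principal_submx I A).
Proof.
move=> m0 iS /hermsymmx_spectral[U [d [Uu AE]]] SA.
have Sd : forall i, S (d 0 i) by apply/(spectrum_in_diag S d Uu); rewrite -AE.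
have [i0 [i1 dle]] := row_extrema d m0.
apply: (psdmx_between iS (Sd i0) (Sd i1)).
  rewrite -(principal_submx_scalar I) -principal_submxB.
  apply: psdmx_principal_submx; rewrite AE; apply/psdmx_diag_ge => // i.
  by case/andP: (dle i).
rewrite -(principal_submx_scalar I) -principal_submxB.
apply: psdmx_principal_submx; rewrite AE; apply/psdmx_diag_le => // i.
by case/andP: (dle i).
Qed.

Lemma unitary_diag_affine n (U : 'M[C]_n) (d : 'rV[R]_n) (p q : R) :
  U \is unitarymx ->
  p%:C *: (U *m cdiag d *m U^t*) + q%:C%:M =
  U *m cdiag (p *: d + const_mx q) *m U^t*.
Proof.
move=> Uu; rewrite (scalar_unitary_diag q Uu) map_mxD map_mxZ raddfD /= linearZ /=.
by rewrite mulmxDr mulmxDl -scalemxAr -scalemxAl.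
Qed.

Lemma trfun_affine f n (A : 'M[C]_n) (p q : R) : A \is hermsymmx ->
  trfun f (p%:C *: A + q%:C%:M) = trfun (fun x => f (p * x + q)) A.
Proof.
move=> /hermsymmx_spectral[U [d [Uu AE]]].
rewrite (trfun_diag _ Uu AE) AE unitary_diag_affine//.
rewrite (trfun_diag f Uu erefl); apply: eq_bigr => i _.
by rewrite !mxE.
Qed.

Lemma spectrum_in_affine S S' n (A : 'M[C]_n) (p q : R) : A \is hermsymmx ->
  (forall x, S x -> S' (p * x + q)) -> spectrum_in S A ->
  p%:C *: A + q%:C%:M \is hermsymmx /\ spectrum_in S' (p%:C *: A + q%:C%:M).
Proof.
move=> /hermsymmx_spectral[U [d [Uu AE]]] SS' SA.
have Sd : forall i, S (d 0 i) by apply/(spectrum_in_diag S d Uu); rewrite -AE.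
rewrite AE (unitary_diag_affine d p q Uu); split; first exact: hermsymmx_congr.
by apply/(spectrum_in_diag S' _ Uu) => i; rewrite !mxE; exact: SS'.
Qed.

Lemma principal_submx_affine m (I : {set 'I_m}) (A : 'M[C]_m) (p q : C) :
  principal_submx I (p *: A + q%:M) = p *: principal_submx I A + q%:M.
Proof. by apply/matrixP => i j; rewrite !mxE (inj_eq enum_val_inj). Qed.

Lemma cvg_trfun_affine S f n (A : 'M[C]_n) e : is_interval S ->
  {within S, continuous f} -> S e ->
  A \is hermsymmx -> spectrum_in S A ->
  trfun (fun x => f ((1 - t) * x + t * e)) A @[t --> 0^'+] --> trfun f A.
Proof.
move=> iS /subspace_continuousP fc Se hA SA.
have [U [d [Uu AE]]] := hermsymmx_spectral hA.
have Sd : forall i, S (d 0 i) by apply/(spectrum_in_diag S d Uu); rewrite -AE.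
rewrite (trfun_diag f Uu AE).
under eq_fun do rewrite (trfun_diag _ Uu AE).
apply: cvg_big => [|i _]; first exact: add_continuous.
move: (d 0 i) (Sd i) => x Sx.
have ct : (1 - t) * x + t * e @[t --> 0^'+] --> x.
  have : (1 - t) * x + t * e @[t --> (0 : R)] --> (1 - 0) * x + 0 * e.
    apply: cvgD; apply: cvgM; try exact: cvg_cst; last exact: cvg_id.
    by apply: cvgB; [exact: cvg_cst|exact: cvg_id].
  by rewrite subr0 mul1r mul0r addr0; exact: cvg_at_right_filter.
move=> P /(fc x Sx) PS; have {PS}ctP := ct _ PS.
have : \forall t \near 0^'+,
    S ((1 - t) * x + t * e) -> P (f ((1 - t) * x + t * e)).
  exact: ctP.
apply: filter_app; near=> t => /=; apply.
have t0 : 0 <= t by apply: ltW; near: t; exact: nbhs_right_gt.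
have t1 : t <= 1 by near: t; exact: nbhs_right_le.
have [xe|/ltW ex] := leP x e.
- apply: (iS x e) => //; apply/andP; split; nra.
- apply: (iS e x) => //; apply/andP; split; nra.
Unshelve. all: by end_near. Qed.

End Boundary.

Theorem theorem1 (R : realType) (E : interval R) (f : R -> R)
    (f_cont : {within [set` E], continuous f})
    (f_prim : exists g : R -> R,
      operator_monotone (interior [set` E]) g /\
      primitive_on (interior [set` E]) f g)
    (m : nat) (m_gt0 : (1 <= m)%N) (A : 'M[R[i]]_m)
    (A_herm : A \is hermsymmx) (A_spec : spectrum_in [set` E] A) :
  supermodular (fun I : {set 'I_m} => trfun f (principal_submx I A)).
Proof.
have iE : is_interval [set` E] by exact: interval_is_interval.
case: f_prim => g [gm fg] I J.
have sub K := spectrum_in_principal_submx K m_gt0 iE A_herm A_spec.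
have [[e Se]|E0] := pselect (interior [set` E] !=set0); last first.
  have [U [d [Uu AE]]] := hermsymmx_spectral A_herm.
  have Ed : forall i, [set` E] (d 0 i).
    by apply/(spectrum_in_diag [set` E] d Uu); rewrite -AE.
  have trE K : trfun f (principal_submx K A) = f (d 0 (Ordinal m_gt0)) *+ #|K|.
    have [hK] := sub K; have [V [k [Vu ->]]] := hermsymmx_spectral hK.
    rewrite spectrum_in_diag// (trfun_diag f Vu erefl) => Ek.
    rewrite -[in RHS](card_ord #|K|) -sumr_const; apply: eq_bigr => i _.
    by congr f; apply: (is_interval_interior0 iE E0); [exact: Ek | exact: Ed].
  by rewrite !trE -!mulrnDr cardsUI.
(* The eigenvectors of (1 - t) A[K] + t e do not move with t, so the limit is that
   of a finite sum of values of f. *)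
have lim K : trfun f (principal_submx K ((1 - t)%:C *: A + (t * e)%:C%:M))
    @[t --> 0^'+] --> trfun f (principal_submx K A).
  under eq_fun do rewrite principal_submx_affine trfun_affine ?(sub K).1//.
  have [hK sK] := sub K.
  by apply: (@cvg_trfun_affine R [set` E]) => //; exact: interior_subset.
apply: ler_cvg_to (cvgD (lim I) (lim J))
  (cvgD (lim (I :|: J)%SET) (lim (I :&: J)%SET)) _.
near=> t.
have t0 : 0 < t by near: t; exact: nbhs_right_gt.
have t1 : t <= 1 by near: t; exact: nbhs_right_le.
have inE x : [set` E] x -> interior [set` E] ((1 - t) * x + t * e).
  by move=> Ex; exact: interior_convex.
have [hB SB] := spectrum_in_affine A_herm inE A_spec.
exact: (supermodular_trfun_principal_submx m_gt0
  (is_interval_interior iE) gm fg hB SB).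
Unshelve. all: by end_near. Qed.
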